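(* Let $E$ be a non-empty finite set and let $\rho=\bigotimes_{x\in E}\rho_x$, where each $\rho_x$ is a probability measure on $\mathbb N_0$ with $\rho_x(\{\ell\})>0$ for each $\ell\in\mathbb N_0$, such that $\int\eta(E)^n\,\rho(\mathrm d\eta)<\infty$ for all $n\in\mathbb N$. For each $x\in E$ let $(\mathscr P_n(\cdot,\rho_x))_{n\in\mathbb N_0}$ be the sequence of monic orthogonal polynomials with respect to $\rho_x$. Then, for all $n\in\mathbb N_0$ and $\xi,\eta\in\mathbf N_{<\infty}$: 1. applying $J_n$ to $D_n^{\mathrm{cheap}}$ yields $$\frac1{n!}J_n\bigl(D_n^{\mathrm{cheap}}(\xi,\cdot),\eta\bigr)=\mathbf 1_{\{\xi(E)=n\}}\prod_{x\in E}\frac{1}{\rho_x(\{\xi_x\})\,\xi_x!}\,(\eta_x)_{\xi_x};$$ 2. applying $I_n$ to $D_n^{\mathrm{cheap}}$ yields $$\frac1{n!}I_n\bigl(D_n^{\mathrm{cheap}}(\xi,\cdot),\eta\bigr)=\mathbf 1_{\{\xi(E)=n\}}\prod_{x\in E}\frac{1}{\rho_x(\{\xi_x\})\,\xi_x!}\,\mathscr P_{\xi_x}(\eta_x,\rho_x).$$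
   Context: For finite $E$ (with the discrete $\sigma$-algebra), $\mathbf N_{<\infty}$ is the set of finite $\mathbb N_0$-valued measures on $E$; $\xi\in\mathbf N_{<\infty}$ is identified with $(\xi_x)_{x\in E}:=(\xi(\{x\}))_{x\in E}\in\mathbb N_0^E$, and $\xi(E)=\sum_{x}\xi_x$. Cheap duality function: $D^{\mathrm{cheap}}(\xi,\eta):=\mathbf 1_{\{\eta=\xi\}}/\rho(\{\xi\})$. For $n\ge1$ and $x=(x_1,\dots,x_n)\in E^n$, $D_n^{\mathrm{cheap}}(\xi,x):=D^{\mathrm{cheap}}(\xi,\delta_{x_1}+\dots+\delta_{x_n})$; for $n=0$, $D_0^{\mathrm{cheap}}(\xi):=D^{\mathrm{cheap}}(\xi,0)\in\mathbb R$. $(a)_k:=a(a-1)\cdots(a-k+1)$, $(a)_0:=1$. Monic orthogonal polynomials with respect to $\rho_x$: $\mathscr P_n(\cdot,\rho_x)$ is a real polynomial of degree $n$ with leading coefficient $1$, and $\mathscr P_n(\cdot,\rho_x)$, $\mathscr P_m(\cdot,\rho_x)$ are orthogonal in $L^2(\rho_x)$ for $n\ne m$. For $\eta=\sum_{i=1}^m\delta_{x_i}$ the $n$-th factorial measure is $\eta^{(n)}:=\sum\delta_{(x_{i_1},\dots,x_{i_n})}$, the sum over $n$-tuples in $\{1,\dots,m\}^n$ with pairwise different entries (empty sum $=0$). $J_n(f_n,\eta):=\int f_n\,\mathrm d\eta^{(n)}$ for $n\ge1$ and $J_0(f_0,\eta):=f_0$. Generalized orthogonal polynomials with respect to $\rho$: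 $\mathcal P_n\subset L^2(\rho)$ is the set of linear combinations of maps $\eta\mapsto\int f_k\,\mathrm d\eta^{\otimes k}$, $0\le k\le n$, $f_k:E^k\to\mathbb R$ bounded measurable (constants for $k=0$), $\overline{\mathcal P_n}$ its closure in $L^2(\rho)$. For $n\ge1$, $I_n(f_n,\cdot)$ is the orthogonal projection in $L^2(\rho)$ of $\eta\mapsto\int f_n\,\mathrm d\eta^{\otimes n}$ onto $\overline{\mathcal P_{n-1}}^{\perp}$; $I_0(f_0,\cdot):=f_0$. *)

(* Defs.v *)
From HB Require Import structures.
From mathcomp Require Import all_boot all_order all_algebra.
From mathcomp Require Import all_classical all_reals all_analysis.

Set Implicit Arguments.
Unset Strict Implicit.
Unset Printing Implicit Defensive.

Import Order.TTheory GRing.Theory Num.Theory.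

Local Open Scope classical_set_scope.
Local Open Scope ring_scope.

(* Non-empty finite sets: the measurable structures of MathComp-Analysis are
   built on pointed types; the distinguished point itself is never used. *)
#[short(type="pointedFinType")]
HB.structure Definition PointedFinite := {T of Finite T & Pointed T}.

(* T equipped with the discrete sigma-algebra. *)
Definition discrete_space (T : Type) : Type := T.

HB.instance Definition _ (T : pointedType) := Pointed.on (discrete_space T).
HB.instance Definition _ (T : pointedType) :=
  @isMeasurable.Build default_measure_display (discrete_space T)
    discrete_measurable discrete_measurable0
    discrete_measurableC discrete_measurableU.

(* The finite nat-valued measures on E, xi being identified with the family
   of its point masses.  This type is countable and the evaluations separate
   its points, so that the sigma-algebra generated by the evaluations is the
   discrete one. *)
Definition config (E : finType) : Type := {ffun E -> nat}.

HB.instance Definition _ (E : finType) := Choice.on (config E).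
HB.instance Definition _ (E : finType) :=
  isPointed.Build (config E) [ffun=> 0%N].
HB.instance Definition _ (E : finType) :=
  @isMeasurable.Build default_measure_display (config E)
    discrete_measurable discrete_measurable0
    discrete_measurableC discrete_measurableU.

Definition total_mass (E : finType) (xi : config E) : nat :=
  (\sum_(x : E) xi x)%N.

(* delta_{x_1} + ... + delta_{x_n} *)
Definition config_of (E : finType) (n : nat) (x : n.-tuple E) : config E :=
  [ffun y => \sum_(i < n) (tnth x i == y : nat)]%N.

Section dirac_sum.
Local Open Scope ereal_scope.
Context (R : realType) (T : pointedType) (I : finType).
Variables (P : pred I) (t : I -> T).

Definition dirac_sum (A : set (discrete_space T)) : \bar R :=
  \sum_(i | P i) \d_(t i : discrete_space T) A.

Let dirac_sum0 : dirac_sum set0 = 0.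
Proof. by rewrite /dirac_sum big1. Qed.

Let dirac_sum_ge0 A : 0 <= dirac_sum A.
Proof. by rewrite /dirac_sum; apply: sume_ge0. Qed.

Let dirac_sum_sigma_additive : semi_sigma_additive dirac_sum.
Proof.
move=> F mF tF mUF; rewrite [X in _ --> X](_ : _ =
    lim ((fun n => \sum_(0 <= i < n) dirac_sum (F i)) @ \oo)).
  by apply: is_cvg_ereal_nneg_natsum => k _; exact: sume_ge0.
rewrite nneseries_sum//; apply: eq_bigr => /= i _.
exact: measure_semi_bigcup.
Qed.

HB.instance Definition _ := isMeasure.Build _ _ _ dirac_sum
  dirac_sum0 dirac_sum_ge0 dirac_sum_sigma_additive.

End dirac_sum.
Arguments dirac_sum R {T I} P t.

(* The points of a configuration counted with multiplicity: eta is the sum of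
   the delta_{tag i} over all i in points eta. *)
Definition points (E : finType) (eta : config E) : finType :=
  {x : E & 'I_(eta x)}.

Section measures_on_powers.
Context (R : realType) (E : pointedFinType) (n : nat) (eta : config E).

Definition locations (i : n.-tuple (points eta)) : n.-tuple E :=
  [tuple of map tag i].

(* eta^{(n)}: the points i_1, ..., i_n are pairwise different, but their
   locations in E need not be. *)
Definition factorial_measure :
    {measure set (discrete_space (n.-tuple E)) -> \bar R} :=
  dirac_sum R (fun i : n.-tuple (points eta) => uniq i) locations.

(* eta^{\otimes n}, see power_measure_rectangle *)
Definition power_measure :
    {measure set (discrete_space (n.-tuple E)) -> \bar R} :=
  dirac_sum R (fun _ : n.-tuple (points eta) => true) locations.

End measures_on_powers.
Arguments factorial_measure R {E} n eta.
Arguments power_measure R {E} n eta.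

Lemma sum_points (E : finType) (eta : config E) (F : E -> nat) :
  (\sum_(i : points eta) F (tag i) = \sum_(x : E) eta x * F x)%N.
Proof.
transitivity (\sum_(x : E) \sum_(j : 'I_(eta x)) F x)%N.
  by rewrite sig_big_dep/=.
by apply: eq_bigr => x _; rewrite sum_nat_const card_ord.
Qed.

Lemma power_measure_rectangle (R : realType) (E : pointedFinType) (n : nat)
    (eta : config E) (A : 'I_n -> {set E}) :
  power_measure R n eta [set t | forall k, tnth t k \in A k] =
  (\prod_(k < n) \sum_(x in A k) eta x)%N%:R%:E.
Proof.
rewrite /power_measure /= /dirac_sum.
have -> : (\prod_(k < n) \sum_(x in A k) eta x =
  \prod_(k < n) \sum_(i : points eta) (tag i \in A k))%N.
  apply: eq_bigr => k _; rewrite (sum_points eta (fun x => nat_of_bool (x \in A k))).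
  by rewrite big_mkcond/=; apply: eq_bigr => x _; case: ifP; rewrite ?muln1 ?muln0.
rewrite bigA_distr_bigA natr_sum -sumEFin/=.
pose g (t : n.-tuple (points eta)) := [ffun k => tnth t k].
have gK : cancel g (fun f => [tuple f k | k < n]).
  by move=> t; apply: eq_from_tnth => k; rewrite tnth_mktuple ffunE.
have Kg : cancel (fun f : {ffun 'I_n -> points eta} => [tuple f k | k < n]) g.
  by move=> f; apply/ffunP => k; rewrite ffunE tnth_mktuple.
rewrite (reindex g)/=; last by exists (fun f => [tuple f k | k < n]) => ? _.
apply: eq_bigr => t _; rewrite diracE; congr (_%:R%:E).
under eq_bigr do rewrite ffunE.
have [tA|tA] := boolP (_ \in _).
  rewrite big1// => k _; move: tA; rewrite inE => /(_ k).
  by rewrite tnth_map => ->.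
move: tA; rewrite notin_setE => /existsNP[k]; rewrite tnth_map => /negP/negbTE kA.
by rewrite (bigD1 k)//= kA mul0n.
Qed.

(* A function on the one-point set E^0 stands for the constant f_0. *)
Definition J_factorial (R : realType) (E : pointedFinType) (n : nat) :
    (n.-tuple E -> R) -> config E -> R :=
  match n with
  | 0 => fun f _ => f [tuple]
  | m.+1 => fun f eta => \int[factorial_measure R m.+1 eta]_x f x
  end.

Definition power_integral (R : realType) (E : pointedFinType) (n : nat)
    (f : n.-tuple E -> R) (eta : config E) : R :=
  \int[power_measure R n eta]_x f x.

Section L2.
Context d (T : measurableType d) (R : realType).
Variable mu : {measure set T -> \bar R}.

(* The extended-real integral is used, so that a vanishing integral is never
   an artefact of the conventions for non-integrable functions. *)
Definition L2_orthogonal (f g : T -> R) : Prop :=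
  (\int[mu]_x (f x * g x)%:E = 0)%E.

Definition L2_closure (A : set (T -> R)) : set (T -> R) :=
  [set h | h \in Lfun mu 2%:E /\
    forall e : R, 0 < e -> exists2 p, A p &
      ('N[mu]_2%:E[EFin \o (h \- p)%R] < e%:E)%E].

Definition L2_orthocomplement (A : set (T -> R)) : set (T -> R) :=
  [set h | h \in Lfun mu 2%:E /\ forall p, A p -> L2_orthogonal h p].

(* A representative of the orthogonal projection of g onto the closed subspace
   V of L^2(mu).  It is determined up to mu-null sets, hence pointwise as soon
   as mu charges every point. *)
Definition L2_projection (V : set (T -> R)) (g : T -> R) : T -> R :=
  xget (cst 0) [set h | V h /\ forall v, V v -> L2_orthogonal (g \- h) v].

End L2.

Section generalized_orthogonal_polynomials.
Context (R : realType) (E : pointedFinType).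

(* The span of the maps eta |-> \int f d(eta^{\otimes k}) with k <= n; functions
   on the finite discrete space E^k are bounded and measurable, and for k = 0
   these maps are the constants. *)
Definition gen_poly (n : nat) : set (config E -> R) :=
  [set p | exists (m : nat) (c : 'I_m -> R) (k : 'I_m -> nat)
                  (f : forall j : 'I_m, (k j).-tuple E -> R),
     (forall j, (k j <= n)%N) /\
     p = (fun eta => \sum_(j < m) c j * power_integral (f j) eta)].

Variable rho : probability (config E) R.

Definition I_orth (n : nat) : (n.-tuple E -> R) -> config E -> R :=
  match n with
  | 0 => fun f _ => f [tuple]
  | m.+1 => fun f =>
      L2_projection rho (L2_orthocomplement rho (L2_closure rho (gen_poly m)))
        (power_integral f)
  end.

Definition D_cheap (xi eta : config E) : R :=
  (eta == xi)%:R / fine (rho [set xi]).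

(* For n = 0, config_of is the zero measure. *)
Definition D_cheap_n (n : nat) (xi : config E) (x : n.-tuple E) : R :=
  D_cheap xi (config_of x).

End generalized_orthogonal_polynomials.

(* rho is the product of the rho_ x. *)
Definition is_product_measure (R : realType) (E : finType)
    (rho_ : E -> probability nat R) (rho : probability (config E) R) : Prop :=
  forall A : E -> set nat,
    rho [set eta : config E | forall x, A x (eta x)] =
    (\prod_(x : E) rho_ x (A x))%E.

Definition monic_orthogonal (R : realType) (mu : probability nat R)
    (p : nat -> {poly R}) : Prop :=
  [/\ forall n, size (p n) = n.+1,
      forall n, p n \is monic
    & forall n m, n != m ->
        L2_orthogonal mu (fun k : nat => (p n).[k%:R])
                         (fun k : nat => (p m).[k%:R])].

(* Main.v *)
(* Write (eta)_a for the product over x of (eta_x)_{a_x}, and eta^a for the monomial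
   of exponent a. Integrating f against eta^{(n)} or eta^{\otimes n} gives the sum of
   f(x) (eta)_a, respectively f(x) eta^a, over the tuples x in E^n, where a is the
   configuration of x. For D_n^cheap(xi, .) only the n!/prod_x xi_x! tuples with
   configuration xi contribute (none unless xi(E) = n), which settles the first
   identity and shows that the function to be projected in the second one is a
   multiple of eta^xi.

   For xi(E) = n = m+1 the product h of the P_{xi_x}(eta_x, rho_x) is the projection
   of eta^xi. Since the polynomials are monic, eta^xi - h has degree at most m, so it
   lies in the span of the maps eta |-> \int f d(eta^{\otimes k}) with k <= m. A
   monomial eta^a of degree at most m has a_x < xi_x for some x, so it is orthogonal
   to h already in the coordinate x; by Cauchy-Schwarz h is then orthogonal to the
   closure. The projection is determined pointwise, as rho charges every point. *)
Require Import Defs.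
From mathcomp Require Import all_boot all_order all_algebra.
From mathcomp Require Import all_classical all_reals all_analysis.
From mathcomp Require Import measurable_realfun ring.

Set Implicit Arguments.
Unset Strict Implicit.
Unset Printing Implicit Defensive.

Import Order.TTheory GRing.Theory Num.Theory.

Local Open Scope classical_set_scope.
Local Open Scope ring_scope.

(** * Integrals over tuples of points *)

(** For non-negative functions, enumerating the indices turns [dirac_sum] into a finite sum [msum]
    of measures, each integrated as a Dirac mass. The real-valued case follows from positive and
    negative parts. *)
Lemma integral_dirac_sum (R : realType) (T : pointedType) (I : finType)
    (P : pred I) (t : I -> T) (f : T -> R) :
  \int[dirac_sum R P t]_x f x = \sum_(i | P i) f (t i).
Proof.
have mf (g : discrete_space T -> \bar R) :
  @measurable_fun _ _ (discrete_space T) (\bar R) setT g by [].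
pose s : seq (discrete_space T) := [seq t i | i <- enum P].
pose m k : {measure set (discrete_space T) -> \bar R} := \d_(nth point s k).
have sumE (F : T -> \bar R) :
    (\sum_(i | P i) F (t i) = \sum_(k < size s) F (nth point s k))%E.
  rewrite -(big_mkord xpredT (fun k => F (nth point s k))) -(big_nth _ xpredT).
  by rewrite big_map big_enum.
have ge0E (g : discrete_space T -> \bar R) : (forall x, (0 <= g x)%E) ->
    (\int[dirac_sum R P t]_x g x = \sum_(i | P i) g (t i))%E.
  move=> g0; rewrite (@eq_measure_integral _ _ _ _ (msum m (size s))); last first.
    by move=> A _ _; rewrite /= /dirac_sum (sumE (fun x => \d_(x : discrete_space T) A)).
  rewrite ge0_integral_measure_sum// sumE.
  by apply: eq_bigr => k _; rewrite integral_dirac// diracT mul1e.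
rewrite /Rintegral integralE !ge0E//.
rewrite funerpos funerneg /= !sumEFin -EFinB /= -sumrB.
by apply: eq_bigr => i _; have := congr1 (@^~ (t i)) (funrposBneg f).
Qed.

Lemma sum_tupleS (T : finType) (n : nat) (F : seq T -> nat) :
  (\sum_(t : n.+1.-tuple T) F t = \sum_(p : T) \sum_(t : n.-tuple T) F (p :: t))%N.
Proof.
rewrite pair_big/= (reindex (fun q : T * n.-tuple T => [tuple of q.1 :: q.2]))//=.
exists (fun t : n.+1.-tuple T => (thead t, [tuple of behead t])) => [[p t]|t] _.
  by congr (_, _); apply: val_inj.
by rewrite [RHS]tuple_eta.
Qed.

Lemma config_ofE (E : finType) (n : nat) (x : n.-tuple E) (y : E) :
  config_of x y = count_mem y x.
Proof. by rewrite ffunE -sum1_count [RHS]big_mkcond big_tuple. Qed.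

Lemma total_mass_config_of (E : finType) (n : nat) (x : n.-tuple E) :
  total_mass (config_of x) = n.
Proof.
rewrite /total_mass; under eq_bigr do rewrite ffunE.
rewrite exchange_big/=; under eq_bigr => i _.
  rewrite (bigD1 (tnth x i))//= eqxx big1 ?addn0; last first.
    by move=> y; rewrite eq_sym => /negbTE ->.
  over.
by rewrite sum1_card card_ord.
Qed.

(** * Counting tuples of points with prescribed locations *)

Section counting.
Variables (E : finType) (eta : config E).
Implicit Types (x y : E) (s : seq E).

Lemma sum_points_at x : (\sum_(p : points eta) (tag p == x) = eta x)%N.
Proof.
rewrite (sum_points eta (fun y => y == x : nat)) (bigD1 x)//= eqxx muln1.
by rewrite big1 ?addn0// => y /negbTE ->; rewrite muln0.
Qed.

(** As [t] has no repetition, its points at [x] are as many as the occurrences of [x] among its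
    locations. The subtraction is therefore never truncated. *)
Lemma sum_fresh_points_at (t : seq (points eta)) x : uniq t ->
  (\sum_(p : points eta) ((p \notin t) && (tag p == x)) =
   eta x - count_mem x (map tag t))%N.
Proof.
move=> ut; rewrite -[in RHS](sum_points_at x) count_map.
have -> : count (preim tag (pred1 x)) t =
    (\sum_(p : points eta) ((p \in t) && (tag p == x)))%N.
  rewrite -sum1_count big_mkcond big_uniq//= [LHS]big_mkcond/=.
  by apply: eq_bigr => p _; case: (p \in t); case: eqP.
rewrite -[RHS](addnK (\sum_(p : points eta) ((p \in t) && (tag p == x)))%N).
rewrite subnK; last first.
  by apply: leq_sum => p _; case: (p \in t).
rewrite [X in (X - _)%N](_ : _ = \sum_(p : points eta)
   (((p \notin t) && (tag p == x)) + ((p \in t) && (tag p == x))))%N.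
  by rewrite big_split/= addnK.
by apply: eq_bigr => p _; case: (p \in t); case: (_ == _).
Qed.

(** Only the factor at [x] changes. This is the common induction step for the powers and the falling
    factorials below. *)
Lemma prod_count_cons (F : E -> nat -> nat) x s (c : nat) :
    (F x (count_mem x s).+1 = c * F x (count_mem x s) ->
  \prod_y F y (count_mem y (x :: s)) = c * \prod_y F y (count_mem y s))%N.
Proof.
move=> Fc; rewrite (bigD1 x)//= eqxx Fc [in RHS](bigD1 x)//= mulnA.
by congr (_ * _)%N; apply: eq_bigr => y /negbTE yx; rewrite eq_sym yx.
Qed.

Lemma count_tuples_at n s : size s = n ->
  (\sum_(t : n.-tuple (points eta)) (map tag t == s) =
   \prod_y eta y ^ count_mem y s)%N.
Proof.
elim: s n => [|x s ih] [|n]//=.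
  move=> _; rewrite [RHS]big1// (bigD1 [tuple])//= big1 ?addn0// => t.
  by rewrite (tuple0 t) => /eqP.
case=> sn; rewrite (prod_count_cons (F := fun y k => eta y ^ k)%N x s _ (expnS _ _)) -(ih _ sn).
rewrite (sum_tupleS _ (fun t => nat_of_bool (map tag t == x :: s))) -[in RHS](sum_points_at x).
rewrite big_distrlr/=.
by apply: eq_bigr => p _; apply: eq_bigr => t _; rewrite eqseq_cons mulnb.
Qed.

Lemma count_uniq_tuples_at n s : size s = n ->
  (\sum_(t : n.-tuple (points eta)) (uniq t && (map tag t == s)) =
   \prod_y eta y ^_ count_mem y s)%N.
Proof.
elim: s n => [|x s ih] [|n]//=.
  move=> _; rewrite [RHS]big1// (bigD1 [tuple])//= big1 ?addn0// => t.
  by rewrite (tuple0 t) => /eqP.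
case=> sn; rewrite (prod_count_cons (F := fun y k => eta y ^_ k)%N x s _
  (etrans (ffactnSr _ _) (mulnC _ _))) -(ih _ sn).
rewrite (sum_tupleS _ (fun t => nat_of_bool (uniq t && (map tag t == x :: s)))) exchange_big/=.
rewrite big_distrr/=; apply: eq_bigr => t _.
have [/andP[ut /eqP ts]|] := boolP (uniq t && _).
  rewrite muln1 -ts -sum_fresh_points_at//; apply: eq_bigr => p _.
  by rewrite eqseq_cons ut ts eqxx !andbT.
move=> nt; rewrite muln0 big1// => p _; rewrite eqseq_cons.
by move: nt; case: (uniq t); case: (_ == s); rewrite ?andbF.
Qed.

End counting.

(** The multinomial coefficient of [a] if its total mass is [n], and 0 otherwise. *)
Definition multinomial_count (E : finType) (n : nat) (a : config E) : nat :=
  (\sum_(x : n.-tuple E) (config_of x == a))%N.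

Lemma card_points (E : finType) (a : config E) : #|points a| = total_mass a.
Proof.
rewrite -sum1_card (sum_points a (fun=> 1%N)).
by apply: eq_bigr => x _; rewrite muln1.
Qed.

(* A duplicate-free list of all the points of [a], taken in any order, has the
   locations prescribed by [a]; the orderings are counted in two ways. *)
Lemma multinomial_countE (E : finType) (n : nat) (a : config E) :
  (multinomial_count n a * \prod_y (a y)`! = (total_mass a == n) * n`!)%N.
Proof.
have [an|an] := eqVneq (total_mass a) n; last first.
  rewrite mul0n; suff -> : multinomial_count n a = 0%N by rewrite mul0n.
  rewrite /multinomial_count big1// => x _; apply/eqP; rewrite eqb0.
  by apply: contra an => /eqP <-; rewrite total_mass_config_of.
rewrite mul1n -[in RHS]ffactnn -[X in (X ^_ _)%N](an) -card_points.
rewrite -card_uniq_tuples -sum1_card.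
transitivity (\sum_(t : n.-tuple (points a)) (uniq t))%N; last first.
  rewrite [RHS]big_mkcond/=; apply: eq_bigr => t _; rewrite inE.
  rewrite (_ : all _ t); last by exact/allP.
  by case: (uniq t).
rewrite /multinomial_count big_distrl/=.
transitivity (\sum_(x : n.-tuple E) \sum_(t : n.-tuple (points a))
    (uniq t && (map tag t == x)))%N.
  apply: eq_bigr => x _; rewrite (count_uniq_tuples_at _ (size_tuple x)).
  have [<-|xa] := eqVneq (config_of x) a.
    by rewrite mul1n; apply: eq_bigr => y _; rewrite config_ofE ffactnn.
  (* A non-zero product of falling factorials forces [config_of x] to lie below [a] at every site;
     as both have mass [n], they then coincide. *)
  rewrite mul0n; apply/esym/eqP; rewrite -leqn0 leqNgt; apply: contra xa => xa.
  have le_xa y : (config_of x y <= a y)%N.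
    rewrite leqNgt; apply/negP => lt_ax; move: xa.
    by rewrite (bigD1 y)//= -config_ofE ffact_small.
  apply/eqP/ffunP => y; apply/eqP.
  have [_] := leqif_sum (fun y (_ : true) => leqif_eq (le_xa y)).
  rewrite -/(total_mass _) -/(total_mass _) total_mass_config_of an eqxx.
  by move=> /esym/forallP/(_ y).
rewrite exchange_big/=; apply: eq_bigr => t _.
rewrite (bigD1 [tuple of map tag t])//= eqxx andbT big1 ?addn0// => x.
by rewrite -val_eqE eq_sym /= => /negbTE ->; rewrite andbF.
Qed.

(** * Expansions in powers and falling factorials of the point masses *)

Section monomial_expansions.
Variables (R : realType) (E : pointedFinType).
Implicit Types (a b xi eta : config E) (n : nat).

Definition monomial a eta : R := \prod_x (eta x)%:R ^+ a x.

Lemma sum_comp_image (I T : finType) (Q : pred I) (h : I -> T) (f : T -> R) :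
  \sum_(i | Q i) f (h i) = \sum_x f x * (\sum_i (Q i && (h i == x)))%N%:R.
Proof.
under [RHS]eq_bigr do rewrite natr_sum mulr_sumr.
rewrite exchange_big big_mkcond/=; apply: eq_bigr => i _.
case: ifP => Qi; last by rewrite big1// => x _; rewrite mulr0.
rewrite (bigD1 (h i))//= eqxx mulr1 big1 ?addr0// => x /negbTE.
by rewrite eq_sym => ->; rewrite mulr0.
Qed.

Lemma power_integralE n (f : n.-tuple E -> R) eta :
  power_integral f eta = \sum_x f x * monomial (config_of x) eta.
Proof.
rewrite /power_integral integral_dirac_sum sum_comp_image.
apply: eq_bigr => x _; congr (_ * _).
rewrite (_ : (\sum_i _)%N = \sum_(t : n.-tuple (points eta)) (map tag t == x))%N; last first.
  by apply: eq_bigr => t _.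
rewrite (count_tuples_at _ (size_tuple x)) natr_prod; apply: eq_bigr => y _.
by rewrite natrX config_ofE.
Qed.

Lemma factorial_integralE n (f : n.-tuple E -> R) eta :
  \int[factorial_measure R n eta]_x f x =
  \sum_x f x * \prod_y (eta y ^_ config_of x y)%:R.
Proof.
rewrite integral_dirac_sum sum_comp_image.
apply: eq_bigr => x _; congr (_ * _).
rewrite (_ : (\sum_i _)%N =
  \sum_(t : n.-tuple (points eta)) (uniq t && (map tag t == x)))%N; last first.
  by apply: eq_bigr => t _.
rewrite (count_uniq_tuples_at _ (size_tuple x)) natr_prod; apply: eq_bigr => y _.
by rewrite config_ofE.
Qed.

Lemma multinomial_count_ratio n a :
  (n`!%:R)^-1 * (multinomial_count n a)%:R =
  (total_mass a == n)%:R * \prod_y ((a y)`!%:R)^-1 :> R.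
Proof.
have f0 k : k`!%:R != 0 :> R by rewrite pnatr_eq0 -lt0n fact_gt0.
have p0 : \prod_y (a y)`!%:R != 0 :> R by apply/prodf_neq0 => y _.
rewrite prodfV; apply: (mulIf p0); rewrite -[RHS]mulrA mulVf// mulr1 -mulrA -natr_prod.
by rewrite -natrM multinomial_countE natrM mulrCA mulVf ?mulr1.
Qed.

Lemma sum_D_cheap (rho : probability (config E) R) n xi (G : config E -> R) :
  \sum_(x : n.-tuple E) D_cheap_n rho xi x * G (config_of x) =
  (multinomial_count n xi)%:R * ((fine (rho [set xi]))^-1 * G xi).
Proof.
rewrite natr_sum mulr_suml; apply: eq_bigr => x _.
rewrite /D_cheap_n /D_cheap mulrA; have [->//|] := eqVneq (config_of x) xi.
by rewrite !mul0r.
Qed.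

(** Brings the case n = 0, where [J_factorial] and [I_orth] are defined separately, into the form of
    a sum over tuples. *)
Lemma D_cheap_n_tuple0 (rho : probability (config E) R) xi (G : config E -> R) :
  G [ffun=> 0%N] = 1 ->
  D_cheap_n rho xi [tuple] =
  \sum_(x : 0.-tuple E) D_cheap_n rho xi x * G (config_of x).
Proof.
move=> G1; rewrite (bigD1 [tuple])//= big1 ?addr0; last first.
  by move=> x; rewrite (tuple0 x) => /eqP.
rewrite (_ : config_of _ = [ffun=> 0%N]) ?G1 ?mulr1//.
by apply/ffunP => y; rewrite config_ofE ffunE.
Qed.

Lemma J_D_cheap (rho : probability (config E) R) n xi eta :
  (n`!%:R)^-1 * J_factorial (D_cheap_n rho xi (n := n)) eta =
  (total_mass xi == n)%:R *
  ((fine (rho [set xi]))^-1 * \prod_x (((xi x)`!%:R)^-1 * (eta x ^_ xi x)%:R)).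
Proof.
have -> : J_factorial (D_cheap_n rho xi (n := n)) eta =
    \sum_(x : n.-tuple E) D_cheap_n rho xi x * \prod_y (eta y ^_ config_of x y)%:R.
  case: n => [|n] /=; last exact: factorial_integralE.
  apply: (D_cheap_n_tuple0 _ _ (G := fun a => \prod_y (eta y ^_ a y)%:R)).
  by rewrite big1// => y _; rewrite ffunE.
rewrite (sum_D_cheap _ _ _ (fun a => \prod_y (eta y ^_ a y)%:R)).
rewrite [LHS]mulrA multinomial_count_ratio -mulrA; congr (_ * _).
by rewrite big_split/= mulrCA.
Qed.

End monomial_expansions.

(** * Polynomials in the point masses *)

Section polynomial_functions.
Variables (R : realType) (E : pointedFinType).
Implicit Types (a b xi eta : config E) (f g : config E -> R) (d e n : nat).

(* The degree bound is strict, so that only the zero function is in [polyfun 0]. *)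
Definition polyfun d f : Prop :=
  exists2 s : seq (R * config E), all (fun q => total_mass q.2 < d)%N s &
    f = fun eta => \sum_(q <- s) q.1 * monomial R q.2 eta.

Lemma polyfunW d e f : (d <= e)%N -> polyfun d f -> polyfun e f.
Proof.
by move=> de [s sd ->]; exists s => //; apply: sub_all sd => q /leq_trans; exact.
Qed.

Lemma polyfun0 d : polyfun d (cst 0).
Proof. by exists [::] => //; apply/funext => eta; rewrite big_nil. Qed.

Lemma polyfun_monomial d a : (total_mass a < d)%N -> polyfun d (monomial R a).
Proof.
move=> ad; exists [:: (1, a)]; first by rewrite /= ad.
by apply/funext => eta; rewrite big_seq1 mul1r.
Qed.

Lemma polyfunD d f g : polyfun d f -> polyfun d g ->
  polyfun d (fun eta => f eta + g eta).
Proof.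
move=> [s sd ->] [t td ->]; exists (s ++ t); first by rewrite all_cat sd.
by apply/funext => eta; rewrite big_cat.
Qed.

Lemma polyfunZ d c f : polyfun d f -> polyfun d (fun eta => c * f eta).
Proof.
move=> [s sd ->]; exists [seq (c * q.1, q.2) | q <- s]; first by rewrite all_map.
by apply/funext => eta; rewrite big_map mulr_sumr; apply: eq_bigr => q _; rewrite mulrA.
Qed.

Lemma polyfun_sum (I : Type) (r : seq I) d (F : I -> config E -> R) :
  (forall i, polyfun d (F i)) -> polyfun d (fun eta => \sum_(i <- r) F i eta).
Proof.
move=> pF; elim: r => [|i r ih].
  by under eq_fun do rewrite big_nil; exact: polyfun0.
by under eq_fun do rewrite big_cons; exact: polyfunD.
Qed.

Definition config_add a b : config E := [ffun x => a x + b x]%N.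

Lemma total_massD a b : total_mass (config_add a b) =
  (total_mass a + total_mass b)%N.
Proof. by rewrite /total_mass -big_split; apply: eq_bigr => x _; rewrite ffunE. Qed.

Lemma monomialD a b eta :
  monomial R (config_add a b) eta = monomial R a eta * monomial R b eta.
Proof. by rewrite /monomial -big_split; apply: eq_bigr => x _; rewrite ffunE exprD. Qed.

(** Degrees below [d] and at most [e] add up to a degree below [d + e]; the asymmetric bounds avoid
    a predecessor and cover [d = 0]. *)
Lemma polyfunM d e f g : polyfun d f -> polyfun e.+1 g ->
  polyfun (d + e) (fun eta => f eta * g eta).
Proof.
move=> [s sd ->] [t te ->].
exists [seq (q.1 * r.1, config_add q.2 r.2) | q <- s, r <- t].
  apply/allP => _ /allpairsP[[q r] /= [qs rt ->]] /=; rewrite total_massD -addSn.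
  by rewrite leq_add// -1?ltnS; [exact: (allP sd)|exact: (allP te)].
apply/funext => eta; rewrite big_allpairs_dep/= mulr_suml; apply: eq_bigr => q _.
rewrite mulr_sumr; apply: eq_bigr => r _.
by rewrite monomialD mulrACA.
Qed.

Lemma polyfun_exp d k x : (k < d)%N -> polyfun d (fun eta => (eta x)%:R ^+ k).
Proof.
move=> kd; pose a : config E := [ffun y => if y == x then k else 0%N].
rewrite (_ : (fun _ => _) = monomial R a).
  apply: polyfun_monomial; rewrite /total_mass (bigD1 x)//= ffunE eqxx big1 ?addn0//.
  by move=> y /negbTE yx; rewrite ffunE yx.
apply/funext => eta; rewrite /monomial (bigD1 x)//= ffunE eqxx big1 ?mulr1//.
by move=> y /negbTE yx; rewrite ffunE yx.
Qed.

Lemma polyfun_horner d (p : {poly R}) x :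
  (size p <= d)%N -> polyfun d (fun eta => p.[(eta x)%:R]).
Proof.
move=> pd; under eq_fun do rewrite horner_coef.
apply: polyfun_sum => i; apply: polyfunZ; apply: polyfun_exp.
exact: leq_trans pd.
Qed.

(** The leading terms cancel; for [k = 0] the difference is the zero function. *)
Lemma polyfun_monic_tail (p : {poly R}) k x : p \is monic -> size p = k.+1 ->
  polyfun k (fun eta => (eta x)%:R ^+ k - p.[(eta x)%:R]).
Proof.
move=> /monicP p1 pk.
have -> : (fun eta => (eta x)%:R ^+ k - p.[(eta x)%:R]) =
    fun eta => ('X^k - p).[(eta x)%:R].
  by apply/funext => eta; rewrite hornerD hornerN hornerXn.
apply: polyfun_horner; apply/leq_sizeP => j; rewrite leq_eqVlt => /predU1P[<-|kj].
  by rewrite coefB coefXn eqxx -p1 lead_coefE pk subrr.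
by rewrite coefB coefXn gtn_eqF// nth_default ?pk// subr0.
Qed.

Lemma polyfun_prod_horner (p : E -> {poly R}) xi (s : seq E) :
  (forall x, size (p x) = (xi x).+1) ->
  polyfun (\sum_(x <- s) xi x).+1 (fun eta => \prod_(x <- s) (p x).[(eta x)%:R]).
Proof.
move=> sp; elim: s => [|x s ih].
  rewrite (_ : (fun _ => _) = monomial R [ffun=> 0%N]).
    by apply: polyfun_monomial; rewrite big_nil ltnS /total_mass big1// => y _; rewrite ffunE.
  apply/funext => eta; rewrite big_nil /monomial big1// => y _.
  by rewrite ffunE expr0.
have := polyfunM (polyfun_horner x (eq_leq (sp x))) ih.
by rewrite big_cons; congr polyfun; apply/funext => eta; rewrite big_cons.
Qed.

Lemma polyfun_prod_monic_tail (p : E -> {poly R}) xi :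
  (forall x, p x \is monic) -> (forall x, size (p x) = (xi x).+1) ->
  polyfun (total_mass xi)
    (fun eta => monomial R xi eta - \prod_x (p x).[(eta x)%:R]).
Proof.
move=> mp sp; rewrite /total_mass /monomial.
elim: (index_enum E) => [|x s ih].
  rewrite big_nil; have := polyfun0 0; congr polyfun; apply/funext => eta.
  by rewrite !big_nil subrr.
(* With X the power and p the polynomial at [x], and A, B the products over [s] of the powers and of
   the polynomials, the identity used is XA - pB = (A - B)X + (X - p)B. *)
have xX : polyfun (xi x).+1 (fun eta => (eta x)%:R ^+ xi x) by exact: polyfun_exp.
have tailM := polyfunM (polyfun_monic_tail x (mp x) (sp x)) (polyfun_prod_horner s sp).
have := polyfunM ih xX; rewrite addnC => /polyfunD/(_ tailM).
rewrite big_cons; congr polyfun; apply/funext => eta; rewrite !big_cons.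
ring.
Qed.

Lemma gen_poly_polyfun n f : gen_poly n f -> polyfun n.+1 f.
Proof.
move=> [m [c [k [F [kn ->]]]]]; apply: polyfun_sum => j; apply: polyfunZ.
rewrite (funext (power_integralE (F j))).
apply: polyfun_sum => x; apply: polyfunZ; apply: polyfun_monomial.
by rewrite total_mass_config_of ltnS.
Qed.

(* Integrating the indicator of the tuples with configuration [a] gives a nonzero
   multiple of the monomial of exponent [a]. *)
Lemma polyfun_gen_poly n f : polyfun n.+1 f -> gen_poly n f.
Proof.
move=> [s sn ->].
pose q j := tnth (in_tuple s) j.
exists (size s), (fun j => (q j).1 / (multinomial_count (total_mass (q j).2) (q j).2)%:R),
  (fun j => total_mass (q j).2), (fun j x => (config_of x == (q j).2)%:R).
split=> [j|]; first by rewrite -ltnS (allP sn)// mem_tnth.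
apply/funext => eta; rewrite (big_tnth _ _ s); apply: eq_bigr => j _.
rewrite power_integralE -/(q j).
set M := multinomial_count _ _.
have M0 : M%:R != 0 :> R.
  rewrite pnatr_eq0; apply/eqP => M0; have := multinomial_countE (total_mass (q j).2) (q j).2.
  by rewrite -/M M0 eqxx mul1n mul0n => /esym/eqP; rewrite -leqn0 leqNgt fact_gt0.
rewrite (_ : \sum_x _ = M%:R * monomial R (q j).2 eta) ?mulrA ?divfK//.
rewrite natr_sum mulr_suml; apply: eq_bigr => x _.
by have [->//|] := eqVneq; rewrite !mul0r.
Qed.

End polynomial_functions.

(** * Orthogonality and projections in L2 *)

Section L2_theory.
Context d (T : measurableType d) (R : realType).
Variable mu : {measure set T -> \bar R}.
Implicit Types (f g h : T -> R) (A : set (T -> R)).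

Lemma L2_mul_integrable f g : f \in Lfun mu 2%:E -> g \in Lfun mu 2%:E ->
  mu.-integrable setT (fun x => (f x * g x)%:E).
Proof. by move=> f2 g2; apply/Lfun1_integrable; exact: Lfun2_mul_Lfun1. Qed.

Lemma Lfun2B f g : f \in Lfun mu 2%:E -> g \in Lfun mu 2%:E -> f \- g \in Lfun mu 2%:E.
Proof.
have lt12 : (1 <= 2%:E :> \bar R)%E by rewrite lee_fin ler1n.
exact: rpredB.
Qed.

Lemma L2_orthogonalC f g : L2_orthogonal mu f g -> L2_orthogonal mu g f.
Proof. by rewrite /L2_orthogonal; under eq_integral do rewrite mulrC. Qed.

Lemma L2_orthogonalB f g h : f \in Lfun mu 2%:E -> g \in Lfun mu 2%:E ->
  h \in Lfun mu 2%:E -> L2_orthogonal mu f h -> L2_orthogonal mu g h ->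
  L2_orthogonal mu (f \- g) h.
Proof.
move=> f2 g2 h2 fh gh; rewrite /L2_orthogonal.
under eq_integral do rewrite /= mulrBl EFinB.
by rewrite integralB//; [rewrite fh gh subee|exact: L2_mul_integrable|exact: L2_mul_integrable].
Qed.

Lemma L2_orthogonal_closure A h v : h \in Lfun mu 2%:E ->
    (forall p, A p -> p \in Lfun mu 2%:E /\ L2_orthogonal mu h p) ->
  L2_closure mu A v -> L2_orthogonal mu h v.
Proof.
move=> h2 hA [v2 vA].
have hfin : ('N[mu]_2%:E[EFin \o h] \is a fin_num)%E.
  move: (h2); rewrite inE => /andP[_]; rewrite inE/= /finite_norm => ?.
  by rewrite ge0_fin_numE ?Lnorm_ge0.
set N := fine 'N[mu]_2%:E[EFin \o h].
have N0 : 0 <= N by rewrite fine_ge0// Lnorm_ge0.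
apply/eqP; rewrite -abse_eq0 eq_le abse_ge0 andbT.
apply/lee_addgt0Pr => e e0; rewrite add0e.
(* Since [h] is orthogonal to [p], [v] may be replaced by [v \- p], and Cauchy-Schwarz gives the
   bound N e / (N + 1), at most [e]. Adding 1 keeps the denominator positive when N = 0. *)
have [p Ap vp] := vA (e / (N + 1)) (divr_gt0 e0 (ltr_wpDl N0 ltr01)).
have [p2 hp] := hA p Ap.
have vp2 : (v \- p) \in Lfun mu 2%:E by exact: Lfun2B.
have -> : (\int[mu]_x (h x * v x)%:E = \int[mu]_x (h x * (v \- p) x)%:E)%E.
  under [RHS]eq_integral do rewrite /= mulrBr EFinB.
  by rewrite integralB//; [rewrite hp sube0|exact: L2_mul_integrable|exact: L2_mul_integrable].
have ihvp := L2_mul_integrable h2 vp2.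
apply: (le_trans (le_abse_integral _ _ _)) => //; first exact: measurable_int ihvp.
rewrite -(Lnorm1 mu (fun x => (h x * (v \- p) x)%:E)).
have mh : measurable_fun setT h by move: h2; rewrite inE => /andP[/[!inE]].
have mvp : measurable_fun setT (v \- p) by move: vp2; rewrite inE => /andP[/[!inE]].
have := @hoelder _ _ _ mu h (v \- p) 2 2 mh mvp.
have half2 : 2^-1 + 2^-1 = 1 :> R by rewrite [RHS]splitr !div1r.
rewrite !ltr0n => /(_ isT isT half2) /le_trans; apply.
rewrite -(fineK hfin) -/N (le_trans (lee_pmul _ _ (lexx _) (ltW vp)))//.
  by rewrite Lnorm_ge0.
rewrite -EFinM lee_fin mulrCA ger_pMr// ler_pdivrMr ?ltr_wpDl// mul1r.
by rewrite lerDl.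
Qed.

(** If [k] is the representative chosen by [xget], then [k \- h] lies in the orthocomplement and
    equals (g - h) - (g - k), so it is orthogonal to itself. Positive mass at every point turns this
    into pointwise equality. *)
Lemma L2_projection_orthocomplementE A g h :
    (forall x : T, measurable [set x] /\ (0 < mu [set x])%E) ->
    (forall p, A p -> p \in Lfun mu 2%:E) ->
    g \in Lfun mu 2%:E -> L2_orthocomplement mu A h ->
    (forall v, L2_orthocomplement mu A v -> L2_orthogonal mu (g \- h) v) ->
  L2_projection mu (L2_orthocomplement mu A) g = h.
Proof.
move=> mu_pos A2 g2 Ah gh; rewrite /L2_projection.
case: xgetP => [k _ [Ak gk]|/(_ h)[]//].
have k2 := Ak.1; have h2 := Ah.1.
have kh2 : (k \- h) \in Lfun mu 2%:E by exact: Lfun2B.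
have Akh : L2_orthocomplement mu A (k \- h).
  split=> // p Ap; apply: L2_orthogonalB => //.
  - exact: A2.
  - exact: Ak.2.
  - exact: Ah.2.
have khE : k \- h = (g \- h) \- (g \- k).
  by apply/funext => x /=; ring.
have : L2_orthogonal mu (k \- h) (k \- h).
  rewrite {1}khE; apply: L2_orthogonalB => //; [exact: Lfun2B|exact: Lfun2B|exact: gh|exact: gk].
rewrite /L2_orthogonal => kh0.
apply/funext => x; apply/eqP; rewrite -subr_eq0; apply/negP => /negP khx.
have [mx x_pos] := mu_pos x.
(* The vanishing integral of the square dominates the contribution of the single point [x]. *)
have : (((k x - h x) ^+ 2)%:E * mu [set x] <= 0)%E.
  rewrite -kh0 -integral_cst//.
  apply: (@le_trans _ _ (\int[mu]_(y in [set x]) ((k \- h) y * (k \- h) y)%:E)%E).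
    by rewrite le_eqVlt; apply/predU1P; left; apply: eq_integral => y; rewrite inE => ->.
  apply: ge0_subset_integral => //; first exact: measurable_int (L2_mul_integrable kh2 kh2).
  by move=> y _; rewrite lee_fin -expr2 sqr_ge0.
by apply/negP; rewrite -ltNge mule_gt0// lte_fin exprn_even_gt0.
Qed.

End L2_theory.

(** * Product measures on configurations *)

Lemma integral_nat_fibers d (T : measurableType d) (R : realType)
    (mu : {measure set T -> \bar R}) (D : set T) (X : T -> nat) (g : T -> \bar R) :
    (forall k, measurable (D `&` X @^-1` [set k])) -> mu.-integrable D g ->
  (\int[mu]_(x in D) g x = \sum_(k <oo) \int[mu]_(x in D `&` X @^-1` [set k]) g x)%E.
Proof.
move=> mF ig; have DE : D = \bigcup_k (D `&` X @^-1` [set k]).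
  by apply/seteqP; split=> [t Dt|t [k _ []//]]; exists (X t).
rewrite [in LHS]DE integral_bigcup//; last by rewrite -DE.
by move=> i j _ _ [t [[_ /= <-] [_ /= <-]]].
Qed.

(** Induction on the size: subtracting a multiple of the monic [p m] removes the top coefficient,
    and [p n] is orthogonal to [p m] as m < n. *)
Lemma monic_orthogonal_low (R : realType) (mu : probability nat R) (p : nat -> {poly R})
    (n : nat) (q : {poly R}) :
    (forall r : {poly R}, mu.-integrable setT (fun k : nat => (r.[k%:R])%:E)) ->
    monic_orthogonal mu p -> (size q <= n)%N ->
  (\int[mu]_k ((p n).[k%:R] * q.[k%:R])%:E = 0)%E.
Proof.
move=> ip [sp mp op] qn.
suff H m (r : {poly R}) : (size r <= m)%N -> (m <= n)%N ->
    (\int[mu]_k ((p n).[k%:R] * r.[k%:R])%:E = 0)%E by exact: (H n).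
elim: m r => [|m ih] r rm mn.
  move: rm; rewrite leqn0 size_poly_eq0 => /eqP ->.
  by under eq_integral do rewrite horner0 mulr0; rewrite integral0.
pose s := r - r`_m *: p m.
have sm : (size s <= m)%N.
  apply/leq_sizeP => j; rewrite leq_eqVlt coefB coefZ => /predU1P[<-|mj].
    by have /monicP := mp m; rewrite lead_coefE sp /= => ->; rewrite mulr1 subrr.
  by rewrite nth_default ?(leq_trans rm)// [(p m)`_j]nth_default ?sp// mulr0 subr0.
have -> : (fun k : nat => ((p n).[k%:R] * r.[k%:R])%:E) =
    (fun k : nat => (r`_m)%:E * ((p n * p m).[k%:R])%:E + ((p n * s).[k%:R])%:E)%E.
  apply/funext => k; rewrite -EFinM -EFinD; congr EFin.
  rewrite -[r in LHS](subrK (r`_m *: p m)) -/s hornerD hornerZ !hornerM; ring.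
rewrite integralD//; last exact: integrableZl.
rewrite integralZl//; under eq_integral do rewrite hornerM.
rewrite op ?gtn_eqF// mule0 add0e.
by under eq_integral do rewrite hornerM; apply: ih => //; exact: ltnW.
Qed.

Section product_measure.
Variables (R : realType) (E : pointedFinType).
Variables (rho_ : E -> probability nat R) (rho : probability (config E) R).
Hypothesis rhoE : is_product_measure rho_ rho.
Implicit Types (x y : E) (xi eta a : config E).

Lemma prod_measure_fin_num (Q : pred E) (A : E -> set nat) :
  (\prod_(y | Q y) rho_ y (A y))%E \is a fin_num.
Proof. by apply: prode_fin_num => y _; exact: fin_num_measure. Qed.

Lemma product_measure_set1 xi : rho [set xi] = (\prod_x rho_ x [set xi x])%E.
Proof.
rewrite -(rhoE (fun x => [set xi x])); congr (rho _).
by apply/seteqP; split=> [eta -> //|eta etaE]; apply/ffunP.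
Qed.

Lemma fine_product_measure_set1 xi :
  fine (rho [set xi]) = \prod_x fine (rho_ x [set xi x]).
Proof.
rewrite product_measure_set1; apply: EFin_inj.
rewrite fineK ?prod_measure_fin_num// -prodEFin.
by apply: eq_bigr => x _; rewrite fineK ?fin_num_measure.
Qed.

Lemma product_measure_marginal x (A : set nat) :
  rho [set eta | A (eta x)] = rho_ x A.
Proof.
have := rhoE (fun y => if y == x then A else setT).
rewrite (bigD1 x)//= eqxx big1 ?mule1; last first.
  by move=> y /negbTE ->; rewrite probability_setT.
move=> <-; congr (rho _); apply/seteqP; split=> [eta Ax y|eta /(_ x)]/=.
  by case: eqP => // ->.
by rewrite eqxx.
Qed.

Lemma ge0_integral_marginal x (f : nat -> \bar R) : (forall k, (0 <= f k)%E) ->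
  (\int[rho_ x]_k f k = \int[rho]_eta f (eta x))%E.
Proof.
move=> f0.
have mX : measurable_fun [set: config E] (fun eta : config E => eta x) by [].
rewrite -[RHS](@ge0_integral_pushforward _ _ _ _ _ _ mX rho setT f)//.
by apply: eq_measure_integral => A _ _; exact/esym/product_measure_marginal.
Qed.

Definition eq_off x eta eta' := forall y, y != x -> eta y = eta' y.

(* The fibres over the coordinates other than [x] are countably many, and on each
   of them [f (eta x)] has the integral of [f] up to a constant factor. *)
Lemma integral_coord_factor x (f : nat -> R) (g : config E -> R) :
    (rho_ x).-integrable setT (EFin \o f) -> (\int[rho_ x]_k (f k)%:E = 0)%E ->
    (forall eta eta', eq_off x eta eta' -> g eta = g eta') ->
    rho.-integrable setT (fun eta : config E => (f (eta x))%:E) ->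
    rho.-integrable setT (fun eta : config E => (f (eta x) * g eta)%:E) ->
  (\int[rho]_eta (f (eta x) * g eta)%:E = 0)%E.
Proof.
move=> if_ f0 gx ifx ifg.
(* Resetting the coordinate at [x] to 0 labels the fibre of [eta]; [pickle] turns the label into a
   natural number. *)
pose off eta : {ffun E -> nat} := [ffun y => if y == x then 0%N else eta y].
have offE eta eta' : off eta = off eta' -> eq_off x eta eta'.
  by move=> /ffunP oe y /negbTE yx; have := oe y; rewrite !ffunE yx.
rewrite (@integral_nat_fibers _ _ _ _ _ (fun eta => pickle (off eta)))//.
rewrite eseries0// => j _ _; rewrite setTI; set D := _ @^-1` _.
have [->|/set0P[eta0 Deta0]] := eqVneq D set0; first by rewrite integral_set0.
have DE : D = [set eta | eq_off x eta eta0].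
  apply/seteqP; split=> eta.
    by rewrite /D/= -[in X in X -> _]Deta0 => /(pcan_inj pickleK)/offE.
  move=> ee; rewrite /D/= -Deta0; congr pickle; apply/ffunP => y; rewrite !ffunE.
  by case: eqVneq => // /ee.
transitivity (\int[rho]_(eta in D) ((g eta0)%:E * (f (eta x))%:E))%E.
  apply: eq_integral => eta; rewrite inE DE => /gx ->.
  by rewrite mulrC EFinM.
have ifD : rho.-integrable D (fun eta : config E => (f (eta x))%:E).
  exact: integrableS ifx.
rewrite integralZl// (_ : (\int[_]_(_ in _) _)%E = 0%E) ?mule0//.
rewrite (@integral_nat_fibers _ _ _ _ _ (fun eta : config E => eta x))//.
pose c := fine (\prod_(y | y != x) rho_ y [set eta0 y])%E.
transitivity (\int[rho_ x]_k (c%:E * (f k)%:E))%E; last by rewrite integralZl// f0 mule0.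
rewrite (@integral_nat_fibers _ _ _ _ _ id)//; last exact: integrableZl.
apply: eq_eseriesr => k _; rewrite setTI.
transitivity (\int[rho]_(eta in D `&` [set eta | eta x = k]) (f k)%:E)%E.
  by apply: eq_integral => eta; rewrite inE => -[_ /= ->].
transitivity (\int[rho_ x]_(l in [set k]) (c * f k)%:E)%E; last first.
  by apply: eq_integral => l; rewrite inE => ->.
rewrite !integral_cst// EFinM. rewrite [RHS]muleAC [RHS]muleC; congr (_ * _)%E.
rewrite fineK ?prod_measure_fin_num// DE.
(* The part of the fibre with value [k] at [x] is a rectangle, so the product formula yields the
   factor [c] times the mass of [k] under [rho_ x]. *)
transitivity (rho [set eta | forall y, (if y == x then [set k] else [set eta0 y]) (eta y)]).
  congr (rho _); apply/seteqP; split=> [eta [ee ek] y|eta ee]/=.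
    by case: eqVneq => [->|/ee].
  by split=> [y /negbTE yx|]; [have := ee y; rewrite yx|have := ee x; rewrite eqxx].
rewrite (rhoE (fun y => if y == x then [set k] else [set eta0 y])).
rewrite (bigD1 x)//= eqxx muleC; congr (_ * _)%E.
by apply: eq_bigr => y /negbTE ->.
Qed.

End product_measure.

(** * Orthogonal polynomials in several variables *)

Lemma Lfun2_sqr_integrable d (T : measurableType d) (R : realType)
    (mu : {measure set T -> \bar R}) (f : T -> R) : measurable_fun setT f ->
  mu.-integrable setT (fun x => (f x * f x)%:E) -> f \in Lfun mu 2%:E.
Proof.
move=> mf iff; rewrite inE; apply/andP; split; rewrite inE//=.
rewrite /finite_norm unlock poweR_lty//.
under eq_integral do rewrite /= powR_mulrn// -normrX ger0_norm ?sqr_ge0// expr2.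
exact: integrable_lty.
Qed.

Section moments.
Variables (R : realType) (E : pointedFinType).
Variables (rho_ : E -> probability nat R) (rho : probability (config E) R).
Hypothesis rhoE : is_product_measure rho_ rho.
Hypothesis rho_moments : forall n : nat,
  (\int[rho]_eta (((total_mass eta)%:R : R) ^+ n)%:E < +oo)%E.
Implicit Types (x y : E) (xi eta a : config E) (f g : config E -> R).

Lemma le_total_mass x eta : (eta x <= total_mass eta)%N.
Proof. by rewrite /total_mass (bigD1 x)//= leq_addr. Qed.

Lemma monomial_ge0 a eta : 0 <= monomial R a eta.
Proof. by apply: prodr_ge0 => x _; exact: exprn_ge0. Qed.

(** Bounding each point mass by the total mass reduces integrability of all polynomials to
    [rho_moments]. *)
Lemma monomial_le a eta : monomial R a eta <= (total_mass eta)%:R ^+ total_mass a.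
Proof.
rewrite [total_mass a]/total_mass -prodrXr; apply: ler_prod => x _.
by rewrite exprn_ge0//= lerXn2r ?nnegrE// ler_nat le_total_mass.
Qed.

Lemma monomial_integrable a : rho.-integrable setT (fun eta => (monomial R a eta)%:E).
Proof.
apply/integrableP; split=> //; apply: le_lt_trans (rho_moments (total_mass a)).
apply: ge0_le_integral => //= eta _.
by rewrite lee_fin ger0_norm ?monomial_ge0// monomial_le.
Qed.

Lemma polyfun_integrable n f : polyfun n f -> rho.-integrable setT (fun eta => (f eta)%:E).
Proof.
move=> [s _ ->]; under eq_fun do rewrite -sumEFin.
apply: integrable_sum => // q _.
under eq_fun do rewrite EFinM.
by apply: integrableZl => //; exact: monomial_integrable.
Qed.

Lemma polyfun_Lfun2 n f : polyfun n f -> f \in Lfun rho 2%:E.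
Proof.
move=> pf; apply: Lfun2_sqr_integrable => //.
exact: polyfun_integrable (polyfunM pf (polyfunW (leqnSn n) pf)).
Qed.

Lemma marginal_poly_integrable x (p : {poly R}) :
  (rho_ x).-integrable setT (fun k : nat => (p.[k%:R])%:E).
Proof.
have := @polyfun_integrable _ _ (@polyfun_horner R E (size p) p x (leqnn _)).
move=> /integrableP[_ pfin]; apply/integrableP; split=> //.
by rewrite (ge0_integral_marginal rhoE).
Qed.

Variable P : E -> nat -> {poly R}.
Hypothesis P_orth : forall x : E, monic_orthogonal (rho_ x) (P x).

Definition prod_orthopoly xi eta : R := \prod_x (P x (xi x)).[(eta x)%:R].

Lemma prod_orthopoly_polyfun xi : polyfun (total_mass xi).+1 (prod_orthopoly xi).
Proof.
apply: (polyfun_prod_horner (p := fun x => P x (xi x))) => x.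
by have [sP _ _] := P_orth x; rewrite sP.
Qed.

(* A monomial of smaller degree has a smaller exponent at some site, where the
   one-dimensional orthogonality applies. *)
Lemma prod_orthopoly_monomial xi a : (total_mass a < total_mass xi)%N ->
  L2_orthogonal rho (prod_orthopoly xi) (monomial R a).
Proof.
move=> lt_a_xi; have [x lt_ax] : exists x, (a x < xi x)%N.
  apply/existsP; apply: contraTT lt_a_xi => /existsPn le_xia.
  by rewrite -leqNgt; apply: leq_sum => x _; rewrite leqNgt le_xia.
(* [f] collects the factors at [x], and [g] those at the other sites. *)
pose f (k : nat) : R := (P x (xi x)).[k%:R] * ('X^(a x)).[k%:R].
pose g eta : R := \prod_(y | y != x) (P y (xi y)).[(eta y)%:R] *
                  \prod_(y | y != x) (eta y)%:R ^+ a y.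
have fgE eta : prod_orthopoly xi eta * monomial R a eta = f (eta x) * g eta.
  rewrite /prod_orthopoly /monomial (bigD1 x)//= [X in _ * X](bigD1 x)//=.
  by rewrite mulrACA /f hornerXn.
rewrite /L2_orthogonal; under eq_integral do rewrite fgE.
have fE : f = fun k => (P x (xi x) * 'X^(a x)).[k%:R].
  by apply/funext => k; rewrite hornerM.
apply: (integral_coord_factor rhoE (x := x)).
- by rewrite fE; exact: marginal_poly_integrable.
- apply: (monic_orthogonal_low (marginal_poly_integrable x) (P_orth x)).
  by rewrite size_polyXn.
- move=> eta eta' ee; congr (_ * _); apply: eq_bigr => y yx; by rewrite ee.
- rewrite fE; exact: polyfun_integrable (polyfun_horner x (leqnn _)).
- under eq_fun do rewrite -fgE.
  apply: polyfun_integrable.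
  exact: polyfunM (prod_orthopoly_polyfun xi) (polyfun_monomial R (ltnSn _)).
Qed.

Lemma prod_orthopoly_gen_poly xi n p : (n < total_mass xi)%N -> gen_poly n p ->
  L2_orthogonal rho (prod_orthopoly xi) p.
Proof.
move=> nxi /gen_poly_polyfun[s sn ->]; rewrite /L2_orthogonal.
have iPm a : rho.-integrable setT (fun eta => (prod_orthopoly xi eta * monomial R a eta)%:E).
  apply: polyfun_integrable.
  exact: polyfunM (prod_orthopoly_polyfun xi) (polyfun_monomial R (ltnSn _)).
(* The degree bound is put into the summation as a filter, so that it is available for each term. *)
transitivity (\int[rho]_eta (\sum_(q <- s | (total_mass q.2 < n.+1)%N)
    q.1%:E * (prod_orthopoly xi eta * monomial R q.2 eta)%:E))%E.
  apply: eq_integral => eta _; rewrite -[RHS]big_filter (all_filterP sn) mulr_sumr -sumEFin.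
  by apply: eq_bigr => q _; rewrite -EFinM mulrCA.
rewrite integral_sum//; last by move=> q; exact: integrableZl.
apply: big1 => q qn; rewrite integralZl//.
by rewrite prod_orthopoly_monomial ?mule0// (leq_trans qn).
Qed.

(** * Projection of monomials and of the cheap duality function *)

Hypothesis rho_pos : forall (x : E) (l : nat), (0 < rho_ x [set l])%E.

Lemma product_measure_pos xi : (0 < rho [set xi])%E.
Proof.
rewrite (product_measure_set1 rhoE).
by elim/big_ind: _ => // u v; exact: mule_gt0.
Qed.

Lemma L2_projection_monomial xi n c : total_mass xi = n.+1 ->
  L2_projection rho (L2_orthocomplement rho (L2_closure rho (gen_poly n)))
    (fun eta => c * monomial R xi eta) = (fun eta => c * prod_orthopoly xi eta).
Proof.
move=> xin.
have gen_poly2 p : gen_poly n p -> p \in Lfun rho 2%:E.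
  by move=> /gen_poly_polyfun/polyfun_Lfun2.
have cP2 : (fun eta => c * prod_orthopoly xi eta) \in Lfun rho 2%:E.
  exact: polyfun_Lfun2 (polyfunZ c (prod_orthopoly_polyfun xi)).
apply: L2_projection_orthocomplementE.
- by move=> eta; split=> //; exact: product_measure_pos.
- by move=> p [].
- exact: polyfun_Lfun2 (polyfunZ c (polyfun_monomial R (ltnSn (total_mass xi)))).
- split=> // p; apply: L2_orthogonal_closure => // q nq; split; first exact: gen_poly2.
  rewrite /L2_orthogonal; under eq_integral do rewrite -mulrA EFinM.
  rewrite integralZl//.
    by rewrite (prod_orthopoly_gen_poly _ nq) ?mule0// xin.
  by apply: L2_mul_integrable (gen_poly2 _ nq); exact: polyfun_Lfun2 (prod_orthopoly_polyfun xi).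
(* As [v] is orthogonal to the closure, it suffices that the difference of the two functions lies
   there; it is a generalized polynomial of degree at most [n], approximated by itself. *)
- move=> v [_ vA]; apply: L2_orthogonalC; apply: vA.
  set tail := _ \- _; have ntail : gen_poly n tail.
    apply: polyfun_gen_poly; rewrite -xin.
    have mP x : P x (xi x) \is monic by have [] := P_orth x.
    have sP x : size (P x (xi x)) = (xi x).+1 by have [] := P_orth x.
    have := polyfunZ c (polyfun_prod_monic_tail mP sP).
    by congr polyfun; apply/funext => eta; rewrite mulrBr.
  split; first exact: gen_poly2.
  move=> e e0; exists tail => //.
  rewrite (_ : _ \o _ = cst 0%E) ?Lnorm0 ?lte_fin//.
  by apply/funext => eta /=; rewrite subrr.
Qed.

Lemma I_D_cheap n xi eta :
  (n`!%:R)^-1 * I_orth rho (D_cheap_n rho xi (n := n)) eta =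
  (total_mass xi == n)%:R *
  ((fine (rho [set xi]))^-1 * \prod_x (((xi x)`!%:R)^-1 * (P x (xi x)).[(eta x)%:R])).
Proof.
suff -> : I_orth rho (D_cheap_n rho xi (n := n)) eta =
    (multinomial_count n xi)%:R * ((fine (rho [set xi]))^-1 * prod_orthopoly xi eta).
  rewrite [LHS]mulrA multinomial_count_ratio -mulrA; congr (_ * _).
  by rewrite big_split/= mulrCA.
case: n => [|n] /=.
  rewrite -(sum_D_cheap _ _ _ (fun a => prod_orthopoly a eta)).
  apply: (D_cheap_n_tuple0 _ _ (G := fun a => prod_orthopoly a eta)).
  (* A monic polynomial of degree 0 is the constant 1. *)
  rewrite /prod_orthopoly big1// => x _; rewrite ffunE.
  have [/(_ 0%N) sP /(_ 0%N)/monicP lP _] := P_orth x.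
  by rewrite (size1_polyC (eq_leq sP)) hornerC -lP lead_coefE sP.
pose c a : R := (multinomial_count n.+1 a)%:R / fine (rho [set a]).
have -> : power_integral (D_cheap_n rho xi (n := n.+1)) =
    fun eta' => c xi * monomial R xi eta'.
  apply/funext => eta'; rewrite power_integralE.
  by rewrite (sum_D_cheap _ _ _ (fun a => monomial R a eta')) mulrA.
rewrite mulrA -/(c xi); have [xin|xin] := eqVneq (total_mass xi) n.+1.
  by rewrite L2_projection_monomial.
have c0 : c xi = 0.
  have := multinomial_count_ratio R n.+1 xi; rewrite (negbTE xin) mul0r => /eqP.
  by rewrite mulf_eq0 invr_eq0 pnatr_eq0 gtn_eqF ?fact_gt0//= => /eqP M0; rewrite /c M0 mul0r.
(* When [xi] has the wrong mass, the function to be projected is zero. It is rewritten as 0 times a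
   monomial of mass [n.+1], all placed at one site, so that [L2_projection_monomial] still
   applies. *)
pose zeta : config E := [ffun x => if x == point then n.+1 else 0%N].
have zetan : total_mass zeta = n.+1.
  rewrite /total_mass (bigD1 point)//= ffunE eqxx big1 ?addn0//.
  by move=> x /negbTE xp; rewrite ffunE xp.
have -> : (fun eta' => c xi * monomial R xi eta') = fun eta' => 0 * monomial R zeta eta'.
  by apply/funext => eta'; rewrite c0 !mul0r.
by rewrite L2_projection_monomial// c0 !mul0r.
Qed.

End moments.

Theorem proposition4p1 (R : realType) (E : pointedFinType)
  (rho_ : E -> probability nat R) (rho : probability (config E) R)
  (P : E -> nat -> {poly R})
  (rho_pos : forall (x : E) (l : nat), (0 < rho_ x [set l])%E)
  (rhoE : is_product_measure rho_ rho)
  (rho_moments : forall n : nat,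
     (\int[rho]_eta (((total_mass eta)%:R : R) ^+ n)%:E < +oo)%E)
  (P_orth : forall x : E, monic_orthogonal (rho_ x) (P x))
  (n : nat) (xi eta : config E) :
  (n`!%:R)^-1 * J_factorial (D_cheap_n rho xi (n := n)) eta =
    (total_mass xi == n)%:R *
    \prod_(x : E) ((fine (rho_ x [set xi x]) * (xi x)`!%:R)^-1 *
                   (eta x ^_ xi x)%:R)
  /\
  (n`!%:R)^-1 * I_orth rho (D_cheap_n rho xi (n := n)) eta =
    (total_mass xi == n)%:R *
    \prod_(x : E) ((fine (rho_ x [set xi x]) * (xi x)`!%:R)^-1 *
                   (P x (xi x)).[(eta x)%:R]).
Proof.
(* The mass of [xi] under [rho] is the product of its one-site masses, so its inverse is distributed
   over the sites in both identities. *)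
have factor_rho (F : E -> R) :
    (fine (rho [set xi]))^-1 * \prod_x (((xi x)`!%:R)^-1 * F x) =
    \prod_x ((fine (rho_ x [set xi x]) * (xi x)`!%:R)^-1 * F x).
  rewrite (fine_product_measure_set1 rhoE) -prodfV -big_split/=.
  by apply: eq_bigr => x _; rewrite invfM mulrA.
by split; rewrite -factor_rho; [exact: J_D_cheap|exact: (I_D_cheap rhoE rho_moments P_orth)].
Qed.
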